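(* Let $M$ be a matroid with rank function $\operatorname{rk}$, and let $X$ and $Y$ be flats of $M$ with $\delta(X,Y)>0$. If $M$ has an extension $M'$ such that $\delta_{M'}\big(\operatorname{cl}_{M'}(X),\operatorname{cl}_{M'}(Y)\big)<\delta(X,Y)$, then $M$ is not sticky.
   Context: For subsets $X,Y$ of the ground set of a matroid with rank function $\operatorname{rk}$, the modular defect is $\delta(X,Y)=\operatorname{rk}(X)+\operatorname{rk}(Y)-\operatorname{rk}(X\cup Y)-\operatorname{rk}(X\cap Y)$ ($\delta_{M'}$ denotes the same quantity computed in $M'$); $(X,Y)$ is a modular pair if $\delta(X,Y)=0$. An extension of a matroid $M$ on $E$ is a matroid $N$ on a set $F\supseteq E$ with $N|E=M$. If $N_1,N_2$ are extensions of $M$ on ground sets $F_1,F_2$ with $F_1\cap F_2=E$, an amalgam of $N_1$ and $N_2$ is a matroid on $F_1\cup F_2$ whose restriction to $F_i$ is $N_i$ for $i=1,2$. A matroid $M$ is sticky if for every such pair of extensions $N_1,N_2$ an amalgam exists. *)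

(* Defs.v *)
From HB Require Import structures.
From mathcomp Require Import all_boot all_order all_algebra.
From mathcomp Require Import finmap.

Set Implicit Arguments.
Unset Strict Implicit.
Unset Printing Implicit Defensive.

Local Open Scope fset_scope.

(* Matroids are finite. All ground sets are finite subsets of one ambient type
   K, so that inclusion, union and intersection of different ground sets make
   sense literally. Values of [rk] on sets that are not contained in [ground]
   are unconstrained and carry no information; hence equality of matroids, as in
   N|E = M, is expressed by equality of ranks on subsets of the ground set. *)
Record matroid (K : choiceType) := Matroid {
  ground : {fset K};
  rk : {fset K} -> nat;
  rk_card : forall X, X `<=` ground -> rk X <= #|` X|;
  rk_mono : forall X Y, X `<=` Y -> Y `<=` ground -> rk X <= rk Y;
  rk_submod : forall X Y, X `<=` ground -> Y `<=` ground ->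
    rk (X `|` Y) + rk (X `&` Y) <= rk X + rk Y
}.

Definition cl (K : choiceType) (M : matroid K) (X : {fset K}) : {fset K} :=
  [fset e in ground M | rk M (e |` X) == rk M X].

Definition flat (K : choiceType) (M : matroid K) (X : {fset K}) : Prop :=
  X `<=` ground M /\ cl M X = X.

Definition defect (K : choiceType) (M : matroid K) (X Y : {fset K}) : int :=
  ((rk M X)%:Z + (rk M Y)%:Z - (rk M (X `|` Y))%:Z - (rk M (X `&` Y))%:Z)%R.

(* [extension M N]: N is an extension of M, i.e. N|E = M for E = ground M. *)
Definition extension (K : choiceType) (M N : matroid K) : Prop :=
  ground M `<=` ground N /\
  forall X : {fset K}, X `<=` ground M -> rk N X = rk M X.

Definition amalgam (K : choiceType) (N1 N2 A : matroid K) : Prop :=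
  [/\ ground A = ground N1 `|` ground N2, extension N1 A & extension N2 A].

Definition sticky (K : choiceType) (M : matroid K) : Prop :=
  forall N1 N2 : matroid K,
    extension M N1 -> extension M N2 ->
    ground N1 `&` ground N2 = ground M ->
    exists A : matroid K, amalgam N1 N2 A.

(* For the extensions of M inside K to include, up to renaming of the new
   elements, all finite extensions of M, the ambient type must be infinite. *)
Definition infinite_type (K : choiceType) : Prop :=
  forall A : {fset K}, exists x : K, x \notin A.

(* Main.v *)
(* The second extension N is of Vamos type. Let t be the rank of X `&` Y; add to
   M, freely up to the constraints below, m disjoint pairs of new elements,
   where m > rk M E. Writing G for the set of new elements and A i for G minus
   the i-th pair, X and Y together with A i have rank t + 2m - 1, while
   X `|` Y `|` A i has rank t + 2m. If Z lies in the closures of both X and Y in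
   some extension of N, submodularity bounds the rank of X `&` Y `|` A i `|` Z by
   t + 2m - 2 = rk (X `&` Y `|` A i): Z is spanned by X `&` Y `|` A i for all i.
   As G is independent over X `&` Y and the A i have no common element, Z has
   rank at most t. In M', the common part of the two closures has rank > t, so
   M' and N have no amalgam. *)
Require Import Defs.
From mathcomp Require Import all_boot all_order all_algebra.
From mathcomp Require Import finmap.
From mathcomp Require Import zify.

Set Implicit Arguments.
Unset Strict Implicit.
Unset Printing Implicit Defensive.

Local Open Scope fset_scope.
Local Open Scope nat_scope.

(** * Fresh elements and their partition into pairs *)

Lemma exists_fresh_fset (K : choiceType) (K_inf : infinite_type K)
    (F : {fset K}) (n : nat) :
  exists2 G : {fset K}, F `&` G = fset0 & #|` G| = n.
Proof.
elim: n => [|n [G FG0 cardG]]; first by exists fset0; rewrite ?fsetI0 ?cardfs0.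
have [x] := K_inf (F `|` G); rewrite inE negb_or => /andP[xF xG].
exists (x |` G); last by rewrite cardfsU1 xG cardG.
by rewrite fsetIUr FG0 fsetU0 fsetI1 (negPf xF).
Qed.

Definition nlabels (K : choiceType) (p : K -> nat) (A : {fset K}) : nat :=
  #|` p @` A|.

Lemma nlabels_mono (K : choiceType) (p : K -> nat) (A B : {fset K}) :
  A `<=` B -> nlabels p A <= nlabels p B.
Proof.
by move=> AB; apply/fsubset_leq_card/subset_imfset; apply/fsubsetP.
Qed.

Lemma nlabels_le_size (K : choiceType) (p : K -> nat) (A : {fset K})
    (s : seq nat) :
  {in A, forall x, p x \in s} -> nlabels p A <= size s.
Proof.
move=> ps; rewrite (leq_trans _ (size_undup s)) // -card_fseq.
apply/fsubset_leq_card/fsubsetP => _ /imfsetP[x /= xA ->].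
by rewrite !inE; apply: ps.
Qed.

Lemma nlabelsUI (K : choiceType) (p : K -> nat) (A B : {fset K}) :
  nlabels p (A `|` B) + nlabels p (A `&` B) <= nlabels p A + nlabels p B.
Proof.
rewrite /nlabels imfsetU -(cardfsUI (p @` A) (p @` B)) leq_add2l.
apply: fsubset_leq_card; rewrite fsubsetI.
by rewrite !subset_imfset //= => x; rewrite inE => /andP[].
Qed.

(** Only elements of [B] outside [A] can bring new labels, at most one each. *)
Lemma nlabelsU_le (K : choiceType) (p : K -> nat) (A B : {fset K}) :
  nlabels p (A `|` B) + #|` A `&` B| <= nlabels p A + #|` B|.
Proof.
have -> : A `|` B = A `|` (B `\` A).
  by apply/fsetP => x; rewrite !inE; case: (x \in A).
have := nlabelsUI p A (B `\` A).
have : nlabels p (B `\` A) <= #|` B `\` A| by exact: leq_imfset_card.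
by have := cardfsID A B; rewrite fsetIC; lia.
Qed.

(* G consists of m pairs; p x is the index of the pair containing x. *)
Definition pairing (K : choiceType) (m : nat) (G : {fset K}) (p : K -> nat) :=
  [/\ #|` G| = m + m, {in G, forall x, p x < m}
    & forall A, A `<=` G -> #|` A| <= nlabels p A + nlabels p A].

Lemma nlabels_pairing (K : choiceType) (m : nat) (G : {fset K}) (p : K -> nat)
    (A : {fset K}) :
  pairing m G p -> A `<=` G -> nlabels p A <= m.
Proof.
move=> [_ pm _] AG; rewrite -(size_iota 0 m).
by apply: nlabels_le_size => x xA; rewrite mem_iota pm ?(fsubsetP AG).
Qed.

(** Positions 2i and 2i+1 in the enumeration of [G] form the i-th pair. Among positions of one
    parity the labels are distinct, so [A] splits into two sets of at most [nlabels p A] elements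
    each. *)
Lemma exists_pairing (K : choiceType) (m : nat) (G : {fset K}) :
  #|` G| = m + m -> exists p, pairing m G p.
Proof.
move=> cardG; exists (fun x => (index x G)./2); split=> // [x xG|A AG].
  by move: xG; rewrite -index_mem -/(size _) cardG; lia.
set p := fun x => _.
have half_inj (B : {fset K}) (b : bool) : B `<=` A ->
    {in B, forall x, odd (index x G) = b} -> #|` B| <= nlabels p A.
  move=> BA oddB; apply: leq_trans (nlabels_mono p BA).
  rewrite /nlabels card_in_imfset //= => x y xB yB; rewrite /p => pxy.
  have xG : x \in G by apply: (fsubsetP AG); apply: (fsubsetP BA).
  have yG : y \in G by apply: (fsubsetP AG); apply: (fsubsetP BA).
  suff eq_i : index x G = index y G by rewrite -(nth_index x xG) eq_i nth_index.
  by rewrite -(odd_double_half (index x G)) -(odd_double_half (index y G)) pxy !oddB.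
pose E := [fset x in G | odd (index x G)].
rewrite -(cardfsID E A) leq_add //.
  apply: (half_inj _ true); first exact: fsubsetIl.
  by move=> x; rewrite !inE => /andP[_ /andP[_ ->]].
apply: (half_inj _ false); first exact: fsubsetDl.
move=> x; rewrite !inE => /andP[nE xA]; move: nE.
by rewrite (fsubsetP AG _ xA) => /negbTE.
Qed.

(* The rank in N of S `|` A, where S consists of old and A of new elements. The
   cap m + m keeps the rank of X `|` Y `|` G down to that of X `|` G, as
   submodularity at X `|` G and Y `|` G requires. *)
Definition block_rk (K : choiceType) (M : matroid K) (X Y : {fset K})
    (m : nat) (p : K -> nat) (S A : {fset K}) : nat :=
  minn (#|` A| + rk M S)
    (rk M (X `&` Y) +
      if (S `<=` X) || (S `<=` Y) then m + nlabels p A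
      else minn (m + nlabels p A).+1 (m + m)).

(** * Rank axioms for the blocking extension *)

(** An element of [S] outside the flat [X] raises the rank of [X], hence by submodularity also that
    of the part of [S] inside [X]. *)
Lemma flat_rkI_lt (K : choiceType) (M : matroid K) (X S : {fset K}) :
  flat M X -> S `<=` ground M -> ~~ (S `<=` X) -> rk M (S `&` X) < rk M S.
Proof.
move=> [XE clX] SE /fsubsetPn[e eS eX].
have eE := fsubsetP SE _ eS.
have rkX : rk M X < rk M (e |` X).
  rewrite ltn_neqAle rk_mono ?fsubsetUr ?fsubUset ?fsub1set ?eE // andbT eq_sym.
  by apply: contra eX => eq_rk; rewrite -clX !inE eE eq_rk.
have SIE : e |` (S `&` X) `<=` ground M.
  by rewrite fsubUset fsub1set eE (fsubset_trans (fsubsetIl _ _)).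
have := rk_submod XE SIE.
have -> : X `|` (e |` S `&` X) = e |` X.
  by apply/fsetP => x; rewrite !inE; case: (x \in X); rewrite ?orbT ?andbF ?orbF.
have -> : X `&` (e |` S `&` X) = S `&` X.
  apply/fsetP => x; rewrite !inE; case: (x =P e) => [->|]; rewrite ?(negPf eX) ?andbF //=.
  by case: (x \in X); rewrite ?andbF.
have : rk M (e |` S `&` X) <= rk M S.
  by apply: rk_mono => //; rewrite fsubUset fsub1set eS fsubsetIl.
lia.
Qed.

Lemma block_rk_mono (K : choiceType) (M : matroid K) (X Y : {fset K})
    (m : nat) (G : {fset K}) (p : K -> nat) (S1 S2 A1 A2 : {fset K}) :
  pairing m G p -> S1 `<=` S2 -> S2 `<=` ground M -> A1 `<=` A2 -> A2 `<=` G ->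
  block_rk M X Y m p S1 A1 <= block_rk M X Y m p S2 A2.
Proof.
move=> pairG S12 S2E A12 A2G; rewrite /block_rk.
have := rk_mono S12 S2E; have := fsubset_leq_card A12.
have := nlabels_mono p A12; have := nlabels_pairing pairG A2G.
(* Enlarging [S1] can only lead from the first branch to the second, which is no smaller because
   there are at most [m] labels. *)
have : (S2 `<=` X) || (S2 `<=` Y) -> (S1 `<=` X) || (S1 `<=` Y).
  by case/orP=> h; rewrite (fsubset_trans S12 h) ?orbT.
by case: ifP; case: ifP; lia.
Qed.

(** If cardinality gives both terms on the right, submodularity of [rk M] suffices; if it gives one,
    [nlabelsU_le] trades labels for elements; if it gives none, [nlabelsUI] suffices except in the
    case handled by [rkXY]. *)
Lemma block_rk_submod (K : choiceType) (M : matroid K) (X Y : {fset K})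
    (m : nat) (G : {fset K}) (p : K -> nat) (S1 S2 A1 A2 : {fset K}) :
  pairing m G p -> flat M X -> flat M Y ->
  S1 `<=` ground M -> S2 `<=` ground M -> A1 `<=` G -> A2 `<=` G ->
  block_rk M X Y m p (S1 `|` S2) (A1 `|` A2) +
    block_rk M X Y m p (S1 `&` S2) (A1 `&` A2) <=
  block_rk M X Y m p S1 A1 + block_rk M X Y m p S2 A2.
Proof.
move=> pairG flX flY S1E S2E A1G A2G.
have SIE : S1 `&` S2 `<=` ground M by exact: fsubset_trans (fsubsetIl _ _) S1E.
have AIG : A1 `&` A2 `<=` G by exact: fsubset_trans (fsubsetIl _ _) A1G.
have AUG : A1 `|` A2 `<=` G by rewrite fsubUset A1G.
have [_ _ /(_ _ AIG) pairI] := pairG.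
have rkM := rk_submod S1E S2E.
have rkI1 := rk_mono (fsubsetIl S1 S2) S1E.
have rkI2 := rk_mono (fsubsetIr S1 S2) S2E.
have tauU := nlabels_pairing pairG AUG.
have tau1 := nlabels_mono p (fsubsetUl A1 A2).
have tau2 := nlabels_mono p (fsubsetUr A1 A2).
have tauI1 := nlabels_mono p (fsubsetIl A1 A2).
have tauI2 := nlabels_mono p (fsubsetIr A1 A2).
have tauUI := nlabelsUI p A1 A2.
have tauU1 := nlabelsU_le p A1 A2.
have := nlabelsU_le p A2 A1; rewrite fsetUC fsetIC => tauU2.
have cardUI := cardfsUI A1 A2.
(* When cardinality gives one term and labels the other, the union may gain the extra 1 by leaving a
   flat; this strict drop of rank pays for it. *)
have rkI_lt (Z : {fset K}) (S S' : {fset K}) : flat M Z -> S `<=` Z ->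
    S' `<=` ground M -> ~~ (S' `<=` Z) -> rk M (S `&` S') < rk M S'.
  move=> flZ SZ S'E S'Z; apply: leq_ltn_trans (flat_rkI_lt flZ S'E S'Z).
  apply: rk_mono; first by rewrite fsetIC fsetIS.
  exact: fsubset_trans (fsubsetIl _ _) S'E.
(* One set lies in [X], the other in [Y], and labels give both terms. With t the rank of the
   intersection of [X] and [Y], the cap bounds the union by t + 2m, and cardinality bounds the
   intersection by t plus twice its number of labels ([pairI]). *)
have rkXY : (S1 `<=` X) && (S2 `<=` Y) || (S1 `<=` Y) && (S2 `<=` X) ->
    rk M (S1 `&` S2) <= rk M (X `&` Y).
  have XYE : X `&` Y `<=` ground M.
    by rewrite (fsubset_trans (fsubsetIl _ _)) //; case: flX.
  case/orP=> /andP[h1 h2]; apply: rk_mono => //; last rewrite fsetIC; exact: fsetISS.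
have sIX : (S1 `<=` X) || (S2 `<=` X) -> S1 `&` S2 `<=` X.
  by move=> h; rewrite fsubIset.
have sIY : (S1 `<=` Y) || (S2 `<=` Y) -> S1 `&` S2 `<=` Y.
  by move=> h; rewrite fsubIset.
have X1 := rkI_lt X S1 S2 flX; have X2 := rkI_lt X S2 S1 flX.
have Y1 := rkI_lt Y S1 S2 flY; have Y2 := rkI_lt Y S2 S1 flY.
rewrite [S2 `&` S1]fsetIC in X2 Y2.
rewrite S1E S2E in X1 X2 Y1 Y2.
rewrite /block_rk !fsubUset; clear - pairI rkM rkI1 rkI2 tauU tau1 tau2 tauI1 tauI2 tauUI tauU1 tauU2 cardUI rkXY sIX sIY X1 X2 Y1 Y2.
move: (S1 `<=` X) (S1 `<=` Y) (S2 `<=` X) (S2 `<=` Y) (S1 `&` S2 `<=` X) (S1 `&` S2 `<=` Y) rkXY sIX sIY X1 X2 Y1 Y2.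
by do 6! [case] => /= rkXY sIX sIY X1 X2 Y1 Y2; lia.
Qed.

Lemma exists_block (K : choiceType) (M : matroid K) (X Y : {fset K})
    (m : nat) (G : {fset K}) (p : K -> nat) :
  pairing m G p -> flat M X -> flat M Y -> ground M `&` G = fset0 ->
  exists2 N : matroid K, ground N = ground M `|` G
    & forall S A, S `<=` ground M -> A `<=` G ->
        rk N (S `|` A) = block_rk M X Y m p S A.
Proof.
move=> pairG flX flY EG0.
pose f Q := block_rk M X Y m p (Q `&` ground M) (Q `&` G).
have f_card Q : Q `<=` ground M `|` G -> f Q <= #|` Q|.
  move=> QEG; rewrite (leq_trans (geq_minl _ _)) //.
  have -> : #|` Q| = #|` Q `&` ground M| + #|` Q `&` G|.
    rewrite -cardfsUI -fsetIUr (fsetIidPl QEG) -fsetIIr EG0 fsetI0 cardfs0.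
    by rewrite addn0.
  by rewrite addnC leq_add2r rk_card ?fsubsetIr.
have f_mono Q Q' : Q `<=` Q' -> Q' `<=` ground M `|` G -> f Q <= f Q'.
  by move=> QQ' _; apply: (block_rk_mono _ _ pairG); rewrite ?fsetSI ?fsubsetIr.
have f_submod Q Q' : Q `<=` ground M `|` G -> Q' `<=` ground M `|` G ->
    f (Q `|` Q') + f (Q `&` Q') <= f Q + f Q'.
  move=> _ _; rewrite /f !fsetIUl (fsetIIl _ _ (ground M)) (fsetIIl _ _ G).
  by apply: (block_rk_submod pairG flX flY); rewrite ?fsubsetIr.
exists (Matroid f_card f_mono f_submod) => // S A SE AG /=.
have AE0 : A `&` ground M = fset0.
  by apply/eqP; rewrite -fsubset0 -EG0 fsetIC fsetIS.
have SG0 : S `&` G = fset0.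
  by apply/eqP; rewrite -fsubset0 -EG0 fsetSI.
rewrite /f !fsetIUl AE0 SG0 fsetU0 fset0U.
by rewrite (fsetIidPl SE) (fsetIidPl AG).
Qed.

(** * Bounding the sets spanned by both flats *)

(** Submodularity is applied to [Q] and the union of [X] and [Z], which meet in a set containing
    [X]. *)
Lemma rk_absorb (K : choiceType) (L : matroid K) (X Z Q : {fset K}) :
  Q `<=` ground L -> Z `<=` ground L -> X `<=` Q ->
  rk L (X `|` Z) = rk L X -> rk L (Q `|` Z) <= rk L Q.
Proof.
move=> QL ZL XQ rkXZ.
have XZL : X `|` Z `<=` ground L by rewrite fsubUset ZL (fsubset_trans XQ).
have := rk_submod XZL QL; rewrite rkXZ.
have -> : X `|` Z `|` Q = Q `|` Z.
  by rewrite fsetUAC; congr (_ `|` _); apply/fsetUidPr.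
have : rk L X <= rk L ((X `|` Z) `&` Q).
  apply: rk_mono; first by rewrite fsubsetI fsubsetUl.
  exact: fsubset_trans (fsubsetIr _ _) QL.
by lia.
Qed.

(** [F] will be the ground set of [M'], [L] an amalgam and [Z] the intersection of the two
    closures. *)
Lemma blocking_extension (K : choiceType) (K_inf : infinite_type K)
    (M : matroid K) (X Y F : {fset K}) :
  flat M X -> flat M Y -> ~~ (X `<=` Y) -> ~~ (Y `<=` X) -> ground M `<=` F ->
  exists N : matroid K,
    [/\ extension M N, F `&` ground N = ground M
      & forall (L : matroid K) (Z : {fset K}), extension N L ->
          Z `<=` ground L -> rk L (X `|` Z) = rk M X ->
          rk L (Y `|` Z) = rk M Y -> rk L Z <= rk M (X `&` Y)].
Proof.
move=> flX flY XY YX EF.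
have [[XE _] [YE _]] := (flX, flY).
pose t := rk M (X `&` Y); pose m := (rk M (ground M)).+1.
have [G FG0 cardG] := exists_fresh_fset K_inf F (m + m).
have [p pairG] := exists_pairing cardG.
have EG0 : ground M `&` G = fset0.
  by apply/eqP; rewrite -fsubset0 -FG0 fsetSI.
have [N gN rkN] := exists_block pairG flX flY EG0.
(* Here the size of [m] matters: without new elements the second term of the minimum is at least
   [m], above every rank in [M]. *)
have rkNM S : S `<=` ground M -> rk N S = rk M S.
  move=> SE; rewrite -(fsetU0 S) rkN ?fsub0set // fsetU0 /block_rk.
  rewrite cardfs0 add0n; apply/minn_idPl.
  have : rk M S < m by rewrite ltnS rk_mono.
  by case: ifP => _; clear; lia.
exists N; split; first by split; rewrite // gN fsubsetUl.
  by rewrite gN fsetIUr FG0 fsetU0; apply/fsetIidPr.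
move=> L Z [NL rkLN] ZL rkXZ rkYZ.
have EL : ground M `<=` ground L by rewrite (fsubset_trans _ NL) // gN fsubsetUl.
have GL : G `<=` ground L by rewrite (fsubset_trans _ NL) // gN fsubsetUr.
have rkL S A : S `<=` ground M -> A `<=` G ->
    rk L (S `|` A) = block_rk M X Y m p S A.
  by move=> SE AG; rewrite rkLN ?rkN // gN fsetUSS.
have rkLM S : S `<=` ground M -> rk L S = rk M S.
  by move=> SE; rewrite rkLN ?rkNM // gN (fsubset_trans SE) ?fsubsetUl.
rewrite -rkLM // in rkXZ; rewrite -rkLM // in rkYZ.
have SAL S A : S `<=` ground M -> A `<=` G -> S `|` A `<=` ground L.
  by move=> SE AG; rewrite fsubUset (fsubset_trans SE) // (fsubset_trans AG).
have rkXAZ A : A `<=` G -> rk L (X `|` A `|` Z) <= t + (m + nlabels p A).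
  move=> AG; have XAL := SAL _ _ XE AG.
  rewrite (leq_trans (rk_absorb XAL ZL (fsubsetUl _ _) rkXZ)) //.
  by rewrite rkL // /block_rk fsubset_refl geq_minr.
have rkYAZ A : A `<=` G -> rk L (Y `|` A `|` Z) <= t + (m + nlabels p A).
  move=> AG; have YAL := SAL _ _ YE AG.
  rewrite (leq_trans (rk_absorb YAL ZL (fsubsetUl _ _) rkYZ)) //.
  by rewrite rkL // /block_rk fsubset_refl orbT geq_minr.
have XYE : X `|` Y `<=` ground M by rewrite fsubUset XE.
(* Neither flat contains the other, so the rank drops strictly from the union to [Y] and again to
   the intersection. *)
have rkXY : t.+2 <= rk M (X `|` Y).
  have := flat_rkI_lt flX YE YX; rewrite fsetIC => tY.
  have : rk M ((X `|` Y) `&` Y) < rk M (X `|` Y).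
    by apply: flat_rkI_lt; rewrite // fsubUset negb_and XY.
  by rewrite (fsetIidPr (fsubsetUr X Y)); apply: leq_trans.
have TE : X `&` Y `<=` ground M by rewrite (fsubset_trans (fsubsetIl _ _)).
pose A i := [fset x in G | p x != i].
have AG i : A i `<=` G by exact: fset_sub.
have rkAZ i : i < m -> rk L (X `&` Y `|` A i `|` Z) + 2 <= t + (m + m).
  move=> im.
  (* Label [i] is lost, and at most two elements carry it. So [A i] has exactly m - 1 labels, and by
     [rkXY] the cardinality term for the union of [X], [Y] and [A i] is at least t + 2m. *)
  have nA : (nlabels p (A i)).+1 <= m.
    have im' : i \in iota 0 m by rewrite mem_iota.
    rewrite -(size_iota 0 m) (perm_size (perm_to_rem im')) ltnS.
    apply: nlabels_le_size => x; rewrite !inE => /andP[xG pxi].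
    by rewrite mem_rem_uniq ?iota_uniq // inE pxi mem_iota; case: pairG => _ ->.
  have cardA : m + m <= #|` A i| + 2.
    rewrite -cardG -(cardfsID (A i) G) (fsetIidPr (AG i)) leq_add2l.
    have [_ _ /(_ (G `\` A i) (fsubsetDl _ _))] := pairG.
    have : nlabels p (G `\` A i) <= size [:: i].
      apply: nlabels_le_size => x; rewrite !inE => /andP[h xG]; move: h.
      by rewrite xG negbK.
    by rewrite /=; clear; lia.
  have nA2 : #|` A i| <= nlabels p (A i) + nlabels p (A i) by case: pairG => _ _ ->.
  have PL : X `|` A i `|` Z `<=` ground L by rewrite fsubUset ZL SAL.
  have QL : Y `|` A i `|` Z `<=` ground L by rewrite fsubUset ZL SAL.
  have := rk_submod PL QL.
  have : rk L (X `|` Y `|` A i) <= rk L ((X `|` A i `|` Z) `|` (Y `|` A i `|` Z)).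
    apply: rk_mono; last by rewrite fsubUset PL.
    by apply/fsubsetP => x; rewrite !inE => /orP[/orP[]|] ->; rewrite ?orbT.
  rewrite rkL // /block_rk !fsubUset !fsubset_refl (negPf XY) (negPf YX) /=.
  have : rk L (X `&` Y `|` A i `|` Z)
      <= rk L ((X `|` A i `|` Z) `&` (Y `|` A i `|` Z)).
    apply: rk_mono; last exact: fsubset_trans (fsubsetIl _ _) PL.
    by rewrite -!fsetUIl.
  have := rkXAZ _ (AG i); have := rkYAZ _ (AG i).
  rewrite -/t; clear -rkXY nA cardA nA2; lia.
(* [B j] is the intersection within [G] of the [A i] with i < j; it shrinks from [G] at 0 to the
   empty set at [m]. *)
pose B j := [fset x in G | j <= p x].
have BG j : B j `<=` G by exact: fset_sub.
have TSL S : S `<=` G -> X `&` Y `|` S `|` Z `<=` ground L.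
  by move=> SG; rewrite fsubUset ZL SAL.
(* [B j] and [A j] have union [G], which together with the intersection of [X] and [Y] has rank t +
   2m; so by [rkAZ] each step lowers the bound by 2. *)
have rkBZ j : j <= m -> rk L (X `&` Y `|` B j `|` Z) + (j + j) <= t + (m + m).
  elim: j => [_|j IHj jm].
    have nG := nlabels_pairing pairG (fsubset_refl G).
    have le_XG : rk L (X `&` Y `|` B 0 `|` Z) <= rk L (X `|` G `|` Z).
      apply: rk_mono; last by rewrite fsubUset ZL SAL.
      by rewrite !fsetUSS ?fsubsetIl.
    rewrite !addn0 (leq_trans le_XG) // (leq_trans (rkXAZ _ (fsubset_refl G))) //.
    by rewrite !leq_add2l.
  have := rk_submod (TSL _ (BG j)) (TSL _ (AG j)).
  have : rk L (X `&` Y `|` G)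
      <= rk L ((X `&` Y `|` B j `|` Z) `|` (X `&` Y `|` A j `|` Z)).
    apply: rk_mono; last by rewrite fsubUset !TSL.
    apply/fsubsetP => x; rewrite !inE => /orP[->//|xG]; rewrite xG /=.
    by case: (ltngtP (p x) j); rewrite ?orbT.
  rewrite rkL // /block_rk fsubsetIl /= cardG -/t.
  have nG : m <= nlabels p G.
    by have [_ _ /(_ _ (fsubset_refl G))] := pairG; rewrite cardG; clear; lia.
  have : rk L (X `&` Y `|` B j.+1 `|` Z)
      <= rk L ((X `&` Y `|` B j `|` Z) `&` (X `&` Y `|` A j `|` Z)).
    apply: rk_mono; last by rewrite (fsubset_trans (fsubsetIl _ _)) ?TSL.
    rewrite -fsetUIl -fsetUIr !fsetUSS //; apply/fsubsetP => x.
    by rewrite !inE => /andP[-> jx] /=; rewrite ltnW // neq_ltn jx orbT.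
  by have := IHj (ltnW jm); have := rkAZ _ jm; clear -nG; lia.
have := rkBZ m (leqnn m).
have : rk L Z <= rk L (X `&` Y `|` B m `|` Z).
  by rewrite rk_mono ?fsubsetUr ?TSL.
by rewrite -/t; clear; lia.
Qed.

(** * Closures and the contradiction in an amalgam *)

Lemma sub_cl (K : choiceType) (M : matroid K) (X : {fset K}) :
  X `<=` ground M -> X `<=` cl M X.
Proof.
move=> XE; apply/fsubsetP => x xX; rewrite !inE (fsubsetP XE) //=.
by rewrite (fsetUidPr _ _ _) ?fsub1set.
Qed.

(** [cl] tests single elements only; they are adjoined one at a time, each leaving the rank
    unchanged by [rk_absorb]. *)
Lemma rk_cl (K : choiceType) (M : matroid K) (X : {fset K}) :
  X `<=` ground M -> rk M (cl M X) = rk M X.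
Proof.
move=> XE.
have XcX := sub_cl XE.
have cXE : cl M X `<=` ground M by exact: fset_sub.
suff rkU (s : seq K) : {subset s <= cl M X} -> rk M (X `|` [fset x in s]) = rk M X.
  have := rkU (cl M X) (fun _ => id); move: (cl M X) XcX => C XC <-.
  congr (rk M _); apply/fsetP => x; rewrite !inE orbC.
  by have := fsubsetP XC x; case: (x \in C) => //= /implyP; case: (x \in X).
elim: s => [_|e s IHs es]; first by rewrite (_ : [fset x in [::]] = fset0) ?fsetU0 //; apply/fsetP => x; rewrite !inE.
have eX : e \in cl M X by rewrite es ?mem_head.
have sX : {subset s <= cl M X} by move=> x xs; rewrite es // inE xs orbT.
have sE : X `|` [fset x in s] `<=` ground M.
  rewrite fsubUset XE; apply/fsubsetP => x; rewrite !inE => xs.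
  by apply: (fsubsetP cXE); apply: sX.
have eE : [fset e] `<=` ground M by rewrite fsub1set (fsubsetP cXE).
have rke : rk M (X `|` [fset e]) = rk M X.
  by move: eX; rewrite !inE fsetUC => /andP[_ /eqP].
have := rk_absorb sE eE (fsubsetUl _ _) rke; rewrite IHs //.
have -> : X `|` [fset x in s] `|` [fset e] = X `|` [fset x in e :: s].
  by apply/fsetP => x; rewrite !inE orbAC orbA.
have : rk M X <= rk M (X `|` [fset x in e :: s]).
  rewrite rk_mono ?fsubsetUl // fsubUset XE; apply/fsubsetP => x; rewrite !inE => xs.
  by apply: (fsubsetP cXE); apply: es.
by move=> h1 h2; apply/eqP; rewrite eqn_leq h2 h1.
Qed.

Unset Implicit Arguments.

Theorem theorem3 (K : choiceType) (K_inf : infinite_type K)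
  (M : matroid K) (X Y : {fset K})
  (flatX : flat M X) (flatY : flat M Y)
  (defect_gt0 : (0 < defect M X Y)%R)
  (M' : matroid K) (extM' : extension M M')
  (defect_lt : (defect M' (cl M' X) (cl M' Y) < defect M X Y)%R) :
  ~ sticky M.
Proof.
have [EE' rkM'] := extM'; have [[XE _] [YE _]] := (flatX, flatY).
(* Comparable sets have defect zero. *)
have XY : ~~ (X `<=` Y).
  apply: contraTN defect_gt0 => XY.
  by rewrite /defect (fsetUidPr _ _ XY) (fsetIidPl XY); lia.
have YX : ~~ (Y `<=` X).
  apply: contraTN defect_gt0 => YX.
  by rewrite /defect (fsetUidPl _ _ YX) (fsetIidPr YX); lia.
have [N [extN gN blockN]] := blocking_extension K_inf flatX flatY XY YX EE'.
move=> /(_ M' N extM' extN gN)[L [gL [EL rkL] extL]].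
have XE' := fsubset_trans XE EE'; have YE' := fsubset_trans YE EE'.
have cXE : cl M' X `<=` ground M' by exact: fset_sub.
have cYE : cl M' Y `<=` ground M' by exact: fset_sub.
pose Z := cl M' X `&` cl M' Y.
have ZE : Z `<=` ground M' by exact: fsubset_trans (fsubsetIl _ _) cXE.
have rkZ V : V `<=` ground M -> Z `<=` cl M' V -> rk L (V `|` Z) = rk M V.
  move=> VE ZV; have VE' := fsubset_trans VE EE'.
  rewrite rkL ?fsubUset ?VE' // -rkM' //; apply/eqP; rewrite eqn_leq.
  rewrite [X in _ && X]rk_mono ?fsubsetUl ?fsubUset ?VE' // andbT.
  rewrite -[X in _ <= X]rk_cl // rk_mono ?fset_sub // fsubUset ZV andbT.
  exact: sub_cl.
have := blockN L Z extL (fsubset_trans ZE EL) (rkZ X XE (fsubsetIl _ _)) (rkZ Y YE (fsubsetIr _ _)).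
rewrite rkL // => rkZ_le.
(* Closures leave the rank of the union unchanged, so only the intersection term can lower the
   defect, and [rkZ_le] excludes that. *)
have rkU : rk M' (cl M' X `|` cl M' Y) = rk M (X `|` Y).
  have XYE : X `|` Y `<=` ground M' by rewrite fsubUset XE'.
  have XYcE : X `|` Y `|` cl M' X `<=` ground M' by rewrite fsubUset XYE.
  have YXYc : Y `<=` X `|` Y `|` cl M' X.
    by rewrite (fsubset_trans (fsubsetUr X Y)) ?fsubsetUl.
  have rkcl V : V `<=` ground M' -> rk M' (V `|` cl M' V) = rk M' V.
    by move=> VE; rewrite (fsetUidPr _ _ (sub_cl VE)) rk_cl.
  have absX := rk_absorb XYE cXE (fsubsetUl _ _) (rkcl X XE').
  have absY := rk_absorb XYcE cYE YXYc (rkcl Y YE').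
  rewrite -rkM' ?fsubUset ?XE //; apply/eqP; rewrite eqn_leq.
  rewrite [X in _ && X]rk_mono ?fsetUSS ?sub_cl ?fsubUset ?cXE // andbT.
  apply: leq_trans (leq_trans absY absX); apply: rk_mono.
    by rewrite fsetUSS ?fsubsetUr.
  by rewrite fsubUset XYcE.
move: defect_lt; rewrite /defect rkU -/Z !rk_cl // (rkM' X) // (rkM' Y) //.
by clear -rkZ_le; lia.
Qed.
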